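(* Let $p$ be a prime. There is a subring $E$ of $\mathbb{Z}_p$ such that: (1) $E$ is a one-dimensional Noetherian Henselian local domain, (2) $\mathbb{Q}_p$ is the fraction field of $E$, and (3) the $E$-adic topology on $\mathbb{Q}_p$ strictly refines the $p$-adic topology on $\mathbb{Q}_p$.
   Context: All rings are commutative with unit; by convention a local ring is not a field; dimension means Krull dimension. A local ring $R$ with maximal ideal $\mathfrak{m}$ is Henselian if for any $g \in R[x]$ and $\alpha \in R$ with $g(\alpha) \equiv 0 \pmod{\mathfrak m}$ and $g'(\alpha) \not\equiv 0 \pmod{\mathfrak m}$ there is $\alpha^* \in R$ with $g(\alpha^* ) = 0$ and $\alpha^* \equiv \alpha \pmod{\mathfrak m}$. If $R$ is a local domain with fraction field $K$, then $\{\alpha R + \beta : \alpha \in K^\times, \beta \in K\}$ is a basis for a non-discrete Hausdorff field topology on $K$, called the $R$-adic topology on $K$. A topology $\mathcal{T}_1$ strictly refines $\mathcal{T}_2$ if every $\mathcal{T}_2$-open set is $\mathcal{T}_1$-open and $\mathcal{T}_1 \ne \mathcal{T}_2$. *)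

(* Defs.v *)
From HB Require Import structures.
From mathcomp Require Import all_boot all_order all_algebra.
From mathcomp Require Import zify.
From mathcomp Require Import boolp classical_sets.
Set Implicit Arguments.
Unset Strict Implicit.
Unset Printing Implicit Defensive.
Import GRing.Theory.
Local Open Scope ring_scope.
Local Open Scope classical_set_scope.

Section CommutativeAlgebra.
Variable R : comNzRingType.
Implicit Types I J M : {pred R}.

(* [idealr_closed] is the library's predicate for *proper* ideals. *)

Definition prime_ideal I : Prop := idealr_closed I /\ prime_idealr_closed I.

Definition maximal_ideal M : Prop :=
  idealr_closed M /\
  forall J, idealr_closed J -> {subset M <= J} -> {subset J <= M}.

Definition is_field : Prop := forall x : R, x != 0 -> exists y, x * y = 1.

(* By convention, a local ring is not a field. *)
Definition local_ring : Prop :=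
  ~ is_field /\
  exists M, maximal_ideal M /\ forall M', maximal_ideal M' -> M' =i M.

Definition generates (s : seq R) I : Prop :=
  forall x, x \in I <-> exists c : nat -> R, x = \sum_(i < size s) c i * s`_i.

(* The unit ideal, which [idealr_closed] excludes, is generated by 1. *)
Definition noetherian : Prop :=
  forall I, idealr_closed I -> exists s : seq R, generates s I.

Definition prime_chain (n : nat) (P : nat -> {pred R}) : Prop :=
  (forall i, (i <= n)%N -> prime_ideal (P i)) /\
  (forall i, (i < n)%N ->
     {subset P i <= P i.+1} /\ ~ {subset P i.+1 <= P i}).

Definition has_krull_dim (d : nat) : Prop :=
  (exists P, prime_chain d P) /\
  (forall n P, prime_chain n P -> (n <= d)%N).

Definition henselian : Prop :=
  local_ring /\
  forall M, maximal_ideal M ->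
  forall (g : {poly R}) (a : R), g.[a] \in M -> g^`().[a] \notin M ->
  exists b : R, g.[b] = 0 /\ b - a \in M.

Definition integral_domain : Prop := GRing.integral_domain_axiom R.

End CommutativeAlgebra.

(* [K] is the fraction field of [R], embedded in [K] through [i]. *)
Definition is_fraction_field (R : comNzRingType) (K : fieldType)
    (i : {rmorphism R -> K}) : Prop :=
  injective i /\ forall z : K, exists a b : R, b != 0 /\ z = i a / i b.

(* A topology on [T] is represented by its family of open sets. *)
Definition topology_of_basis (T : Type) (B : set (set T)) : set (set T) :=
  [set U | forall x, U x -> exists V, [/\ B V, V x & V `<=` U]].

Definition strictly_refines (T : Type) (O1 O2 : set (set T)) : Prop :=
  O2 `<=` O1 /\ O1 <> O2.

Definition adic_topology (R : comNzRingType) (K : fieldType)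
    (i : {rmorphism R -> K}) : set (set K) :=
  topology_of_basis
    [set V | exists a b : K, a != 0 /\ V = [set a * i r + b | r in setT]].

Section SubringType.
Variables (R : comNzRingType) (E : subringClosed R).

Record subring_type := SubringElem {
  subring_val :> R;
  subring_valP : subring_val \in E
}.

HB.instance Definition _ := [isSub for subring_val].
HB.instance Definition _ := [Choice of subring_type by <:].
HB.instance Definition _ := [SubChoice_isSubComNzRing of subring_type by <:].

End SubringType.

(* The product ring of the Z / p^(n+1), n >= 0. The exponent starts at 1 because
   'Z_1 is Z / 2. *)
Section ResidueSequences.
Variable p : nat.

Definition residue_seq := forall n : nat, 'Z_(p ^ n.+1).

HB.instance Definition _ := gen_eqMixin residue_seq.
HB.instance Definition _ := gen_choiceMixin residue_seq.

Implicit Types x y z : residue_seq.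

Let zero : residue_seq := fun=> 0.
Let one : residue_seq := fun=> 1.
Let opp x : residue_seq := fun n => - x n.
Let add x y : residue_seq := fun n => x n + y n.
Let mul x y : residue_seq := fun n => x n * y n.

Let addA : associative add.
Proof. by move=> x y z; apply: functional_extensionality_dep => n; exact: addrA. Qed.
Let addC : commutative add.
Proof. by move=> x y; apply: functional_extensionality_dep => n; exact: addrC. Qed.
Let add0 : left_id zero add.
Proof. by move=> x; apply: functional_extensionality_dep => n; exact: add0r. Qed.
Let addN : left_inverse zero opp add.
Proof. by move=> x; apply: functional_extensionality_dep => n; exact: addNr. Qed.
Let mulA : associative mul.
Proof. by move=> x y z; apply: functional_extensionality_dep => n; exact: mulrA. Qed.
Let mulC : commutative mul.
Proof. by move=> x y; apply: functional_extensionality_dep => n; exact: mulrC. Qed.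
Let mul1 : left_id one mul.
Proof. by move=> x; apply: functional_extensionality_dep => n; exact: mul1r. Qed.
Let mulD : left_distributive mul add.
Proof. by move=> x y z; apply: functional_extensionality_dep => n; exact: mulrDl. Qed.
Let one_neq0 : one != zero.
Proof.
by apply/eqP => /(congr1 (fun x : residue_seq => x 0%N)) /eqP; rewrite oner_eq0.
Qed.

HB.instance Definition _ :=
  GRing.isZmodule.Build residue_seq addA addC add0 addN.
HB.instance Definition _ :=
  GRing.Zmodule_isComNzRing.Build residue_seq mulA mulC mul1 mulD one_neq0.

End ResidueSequences.

(* The ring of p-adic integers, as the inverse limit of the Z / p^(n+1): the
   coherence condition says that [x n.+1] reduces to [x n] modulo p^(n+1). The
   primality proof is a parameter of the type so that the integral domain
   structure can be attached to it. *)
Section PadicIntegers.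
Variable p : nat.

Definition coherent of prime p : {pred residue_seq p} :=
  fun x => `[< forall n, (nat_of_ord (x n.+1))%:R = x n :> 'Z_(p ^ n.+1) >].

Variable p_prime : prime p.

Lemma coherentP (x : residue_seq p) :
  reflect (forall n, (nat_of_ord (x n.+1))%:R = x n :> 'Z_(p ^ n.+1))
          (x \in coherent p_prime).
Proof. exact: asboolP. Qed.

Lemma expp_gt1 n : (1 < p ^ n.+1)%N.
Proof. by rewrite -[1%N](exp1n n.+1) ltn_exp2r // prime_gt1. Qed.

Lemma coherent_natr (x : residue_seq p) n (m : nat) :
  x n.+1 = m%:R -> (nat_of_ord (x n.+1))%:R = m%:R :> 'Z_(p ^ n.+1).
Proof.
move=> ->; rewrite val_Zp_nat ?expp_gt1 //.
rewrite -[LHS]Zp_nat_mod ?expp_gt1 // modn_dvdm ?Zp_nat_mod ?expp_gt1 //.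
by rewrite dvdn_exp2l.
Qed.

Lemma coherent_subring : subring_closed (coherent p_prime).
Proof.
have lift n (a : 'Z_(p ^ n.+1)) : a = (nat_of_ord a)%:R by rewrite natr_Zp.
split=> [|x y /coherentP cx /coherentP cy|x y /coherentP cx /coherentP cy];
  apply/coherentP => n.
- exact: (@coherent_natr 1 n 1).
- apply: (addIr (y n)); rewrite subrK -cx -[in LHS]cy -natrD.
  symmetry; rewrite -[RHS](@coherent_natr (fun m => (x - y) m + y m)) ?natrD //.
    by rewrite subrK.
  by rewrite -!lift.
- rewrite (@coherent_natr _ _ (nat_of_ord (x n.+1) * nat_of_ord (y n.+1))).
    by rewrite natrM cx cy.
  by rewrite natrM -!lift.
Qed.

HB.instance Definition _ :=
  GRing.isSubringClosed.Build (residue_seq p) (coherent p_prime)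
    coherent_subring.

Definition padic_int := subring_type (coherent p_prime).

HB.instance Definition _ := GRing.ComNzRing.on padic_int.

Implicit Types x y z : padic_int.

Definition residue x n : 'Z_(p ^ n.+1) := subring_val x n.

Lemma residueS x n : (nat_of_ord (residue x n.+1))%:R = residue x n.
Proof. by have /coherentP := subring_valP x; exact. Qed.

Lemma residueM x y n : residue (x * y) n = residue x n * residue y n.
Proof. by []. Qed.

Lemma residueD x y n : residue (x + y) n = residue x n + residue y n.
Proof. by []. Qed.

Lemma residue_inj x y : (forall n, residue x n = residue y n) -> x = y.
Proof.
by move=> xy; apply/val_inj/functional_extensionality_dep => n; exact: xy.
Qed.

Lemma residue_modn x m n :
  (m <= n)%N -> nat_of_ord (residue x m) = (nat_of_ord (residue x n) %% p ^ m.+1)%N.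
Proof.
have valE (k : nat) : nat_of_ord (residue x k) = (nat_of_ord (residue x k) %% p ^ k.+1)%N.
  by rewrite modn_small // -[X in (_ < X)%N](Zp_cast (expp_gt1 k)).
elim: n => [|n IHn]; first by rewrite leqn0 => /eqP ->.
rewrite leq_eqVlt ltnS => /predU1P[-> //|le_mn].
rewrite IHn // -residueS val_Zp_nat ?expp_gt1 // modn_dvdm //.
by rewrite dvdn_exp2l.
Qed.

Lemma padic_mulf_eq0 : GRing.integral_domain_axiom padic_int.
Proof.
move=> x y xy0.
have nz z : z != 0 -> exists n, nat_of_ord (residue z n) != 0%N.
  move=> z0; apply: contrapT => res0; case/eqP: z0; apply: residue_inj => n.
  apply/val_inj/eqP; apply: contrapT => /negP nz; apply: res0; exists n.
  exact: nz.
case: (eqVneq x 0) => //= /nz[m xm]; case: eqVneq => //= /nz[n yn].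
pose N := (m + n).+1.
pose a := nat_of_ord (residue x N); pose b := nat_of_ord (residue y N).
have xa : ~~ (p ^ m.+1 %| a)%N.
  by rewrite /dvdn -(@residue_modn x m N) // /N; lia.
have yb : ~~ (p ^ n.+1 %| b)%N.
  by rewrite /dvdn -(@residue_modn y n N) // /N; lia.
have ab : (p ^ N.+1 %| a * b)%N.
  have /(congr1 val) : residue (x * y) N = 0 by rewrite xy0.
  by rewrite residueM /= [X in (_ %% X)%N]Zp_cast ?expp_gt1 // => /eqP.
have a0 : (0 < a)%N by rewrite lt0n; apply: contraNneq xa => ->.
have b0 : (0 < b)%N by rewrite lt0n; apply: contraNneq yb => ->.
move: xa yb ab; rewrite !pfactor_dvdn ?muln_gt0 ?a0 // lognM // /N; lia.
Qed.

Definition padic_unit : {pred padic_int} := fun x => `[< exists y, y * x = 1 >].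

Definition padic_inv x : padic_int :=
  if pselect (exists y, y * x = 1) is left ex then sval (cid ex) else x.

Lemma padic_mulVr : {in padic_unit, left_inverse 1 padic_inv *%R}.
Proof.
move=> x /asboolP ex; rewrite /padic_inv.
by case: pselect => // ex'; exact: svalP (cid ex').
Qed.

Lemma padic_unitP x y : y * x = 1 -> padic_unit x.
Proof. by move=> yx; apply/asboolP; exists y. Qed.

Lemma padic_inv_out : {in [predC padic_unit], padic_inv =1 id}.
Proof.
move=> x /asboolP ex; rewrite /padic_inv.
by case: pselect.
Qed.

HB.instance Definition _ := GRing.ComNzRing_hasMulInverse.Build padic_int
  padic_mulVr padic_unitP padic_inv_out.

HB.instance Definition _ := GRing.ComUnitRing_isIntegral.Build padic_int
  padic_mulf_eq0.

Definition padic_num := {fraction padic_int}.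

HB.instance Definition _ := GRing.Field.on padic_num.

(* The balls b + p^n Z_p form a basis of the p-adic topology. *)
Definition padic_topology : set (set padic_num) :=
  topology_of_basis
    [set V | exists (n : nat) (b : padic_num),
       V = [set p%:R ^+ n * tofrac z + b | z in @setT padic_int]].

Definition subring_to_padic_num (E : subringClosed padic_int) :
  {rmorphism subring_type E -> padic_num} :=
  (@tofrac padic_int) \o (val : subring_type E -> padic_int).

End PadicIntegers.

Arguments padic_topology {p} p_prime.

(* Main.v *)
(* Since Q_p contains a transcendental number t, it carries a derivation d with
   d t = 1, and E is the ring of all x in Z_p with d x in Z_p. If x <> 0 in E has
   valuation n, then p^(2n) lies in x E, because d (p^(2n) / x) = - p^(2n) d x / x^2;
   and E / p^m E embeds in (Z / p^m)^2 through x and d x. So E is Noetherian, and it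
   has dimension 1 because x^2 lies in p E when p divides x. Hensel roots stay in E
   because g(b) = 0 forces d b = - g^d(b) / g'(b). Finally p^n Z_p is never
   contained in E: otherwise d would be continuous, hence 0 because it vanishes on Z. *)

Require Import Defs.
From HB Require Import structures.
From mathcomp Require Import all_boot all_order all_algebra.
From mathcomp Require Import generic_quotient boolp classical_sets.
From mathcomp Require Import ring zify.
Set Implicit Arguments.
Unset Strict Implicit.
Unset Printing Implicit Defensive.
Import GRing.Theory.
Local Open Scope ring_scope.

(** The closure proofs supplied later depend on local hypotheses, so the structure is packed by hand
    and only its membership is remembered. *)
Lemma subringClosed_of (R : nzRingType) (S : {pred R}) :
  subring_closed S -> exists G : subringClosed R, G =i S.
Proof.
move=> S_closed.
pose m := GRing.isSubringClosed.Build R S S_closed.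
by exists (HB.pack_for (subringClosed R) S m) => x.
Qed.

(** * Dual numbers and the extension of derivations by Zorn's lemma *)

Section DualNumbers.
Variable K : fieldType.

(* [(a, b)] stands for [a + b e] with [e ^+ 2 = 0]. *)
Definition dual := (K * K)%type.

HB.instance Definition _ := GRing.Zmodule.on dual.

Definition dual_mul (x y : dual) : dual :=
  (x.1 * y.1, x.1 * y.2 + x.2 * y.1).

Lemma dual_mulA : associative dual_mul.
Proof. by move=> x y z; congr (_, _) => /=; ring. Qed.

Lemma dual_mulC : commutative dual_mul.
Proof. by move=> x y; congr (_, _) => /=; ring. Qed.

Lemma dual_mul1 : left_id ((1, 0) : dual) dual_mul.
Proof. by case=> a b; congr (_, _) => /=; ring. Qed.

Lemma dual_mulD : left_distributive dual_mul +%R.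
Proof. by move=> x y z; congr (_, _) => /=; ring. Qed.

Lemma dual_1_neq0 : ((1, 0) : dual) != 0.
Proof. by apply/eqP => -[/eqP]; rewrite oner_eq0. Qed.

HB.instance Definition _ := GRing.Zmodule_isComNzRing.Build dual
  dual_mulA dual_mulC dual_mul1 dual_mulD dual_1_neq0.

Implicit Types (x y : dual) (f g : {poly dual}) (z c : K).

Lemma dualM x y : x * y = (x.1 * y.1, x.1 * y.2 + x.2 * y.1).
Proof. by []. Qed.

Definition dual_fst x : K := x.1.

Lemma dual_fst_is_zmod_morphism : zmod_morphism dual_fst.
Proof. by []. Qed.

Lemma dual_fst_is_monoid_morphism : monoid_morphism dual_fst.
Proof. by []. Qed.

HB.instance Definition _ :=
  GRing.isZmodMorphism.Build dual K dual_fst dual_fst_is_zmod_morphism.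
HB.instance Definition _ :=
  GRing.isMonoidMorphism.Build dual K dual_fst dual_fst_is_monoid_morphism.

(** Stands in for cancellation, since [K[e]] is not a domain. *)
Lemma dual_lreg x y : x.1 != 0 -> x * y = 0 -> y = 0.
Proof.
rewrite dualM; case: x y => [a b] [u v] /= a0 [/eqP].
rewrite mulf_eq0 (negPf a0) /= => /eqP ->; rewrite mulr0 addr0 => /eqP.
by rewrite mulf_eq0 (negPf a0) /= => /eqP ->.
Qed.

Lemma dual_natr n : (n%:R : dual) = (n%:R, 0).
Proof. by elim: n => // n IH; rewrite -addn1 !natrD IH; congr (_, _); rewrite /= addr0. Qed.

(** Taylor expansion, exact at first order because [(0, c)] has square zero. *)
Lemma horner_dual g z c :
  g.[(z, c) : dual] = g.[(z, 0) : dual] + g^`().[(z, 0) : dual] * ((0, c) : dual).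
Proof.
elim/poly_ind: g => [|g a IH]; first by rewrite deriv0 !horner0 mul0r addr0.
rewrite derivD derivM derivX derivC mulr1 addr0 !hornerE IH.
case: (g.[_]) => u v; case: (g^`().[_]) => u' v'; case: a => a b.
by rewrite !dualM; congr (_, _) => /=; ring.
Qed.

Lemma fst_horner_dual g z c : g.[(z, c) : dual].1 = g.[(z, 0) : dual].1.
Proof. by rewrite horner_dual dualM /= mulr0 addr0. Qed.

(* A subring of [K[e]] on which the first projection is injective is the graph
   of a derivation from a subring of [K] to [K]. *)
Definition derivation_graph (G : {pred dual}) : Prop :=
  forall x, x \in G -> x.1 = 0 -> x = 0.

Hypothesis charK : forall n, n.+1%:R != 0 :> K.

(* If [z] is algebraic over the domain of [G], the value [c] of the derivation
   at [z] is forced by [f(z, c) = 0], where [f] is a polynomial of least degree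
   vanishing at [z]; otherwise any [c] will do. *)
Lemma derivation_graph_extend (G : subringClosed dual) z :
  derivation_graph G ->
  exists c, forall g, g \is a polyOver G ->
    g.[(z, c) : dual].1 = 0 -> g.[(z, c) : dual] = 0.
Proof.
move=> Gder.
pose ann f := [/\ f \is a polyOver G, f != 0 & f.[(z, 0) : dual].1 = 0].
have [|no_ann] := pselect (exists n, `[< exists2 f, ann f & size f = n >]); last first.
  exists 0 => g gG gz; have [->|g0] := eqVneq g 0; first by rewrite horner0.
  by case: no_ann; exists (size g); apply/asboolP; exists g.
move=> ex; have [_ /asboolP[f [fG f0 fz] <-] fmin] := ex_minnP ex.
have size_ann g : g \is a polyOver G -> g.[(z, 0) : dual].1 = 0 ->
    (size g < size f)%N -> g = 0.
  move=> gG gz; apply: contraTeq => g0; rewrite -leqNgt fmin //.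
  by apply/asboolP; exists g.
(* The leading coefficient lies in [G], so it would vanish along with its first component. *)
have lead0 : (lead_coef f).1 != 0.
  apply: contra_neq f0 => /Gder H; apply/eqP; rewrite -lead_coef_eq0 H //.
  exact/polyOverP.
(* By minimality a derivative vanishing at [z] is 0; in characteristic 0 this makes [f] constant,
   against [lead0]. *)
have f'z : f^`().[(z, 0) : dual].1 != 0.
  apply/eqP => /(size_ann _ (polyOver_deriv fG)) f'0.
  have {}f'0 : f^`() = 0.
    by apply: f'0; apply: lt_size_deriv.
  have sf : (size f <= 1)%N.
    rewrite leqNgt; apply/negP => sf.
    have := congr1 (fun g : {poly dual} => g`_(size f).-2) f'0.
    rewrite coef_deriv coef0 -mulr_natl dual_natr.
    have -> : ((size f).-2.+1 = (size f).-1)%N by case: (size f) sf => [|[]].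
    move/dual_lreg => H; move: lead0; rewrite lead_coefE H ?eqxx //=.
    by case: (size f) sf => [|[|n]] //= _; apply: charK.
  by move: fz lead0; rewrite (size1_polyC sf) hornerC lead_coefC => ->; rewrite eqxx.
(* The solution [c] of the linear equation that [horner_dual] yields from f(z, c) = 0. *)
exists (- f.[(z, 0) : dual].2 / f^`().[(z, 0) : dual].1) => g.
set c := _ / _; have fw : f.[(z, c) : dual] = 0.
  rewrite horner_dual dualM /c.
  case: (f.[_]) (f^`().[_]) fz f'z => [u v] [u' v'] /= -> u'0.
  by rewrite !mulr0 !addr0 mulrC divfK //; congr (_, _); rewrite /= ?addr0 ?subrr.
have [n] := ubnP (size g); elim: n g => // n IH g le_gn gG gz.
have [lt_gf|le_fg] := ltnP (size g) (size f).
  by rewrite (@size_ann g) ?horner0 // -(fst_horner_dual _ _ c).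
have [->|g0] := eqVneq g 0; first by rewrite horner0.
(* Pseudo-division: [G] may lack the inverse of [lead_coef f], so [g] is multiplied by this
   coefficient, which [dual_lreg] cancels afterwards. *)
pose h := lead_coef f *: g - lead_coef g *: ('X^(size g - size f) * f).
have hw : h.[(z, c) : dual] = lead_coef f * g.[(z, c) : dual].
  rewrite /h hornerD hornerN !hornerZ hornerM fw. by rewrite !mulr0 subr0.
have [lfG lgG] : lead_coef f \in G /\ lead_coef g \in G.
  by split; apply/polyOverP.
apply: (dual_lreg lead0); rewrite -hw; apply: IH.
- rewrite (leq_trans _ (le_gn : (size g <= n)%N)) // -(prednK (_ : 0 < size g)%N) ?size_poly_gt0 //.
  rewrite ltnS; apply/leq_sizeP => j le_gj.
  have sf : (0 < size f)%N by rewrite size_poly_gt0.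
  rewrite coefB !coefZ coefXnM ifN; last by rewrite -leqNgt; lia.
  have [->|ne_j] := eqVneq j (size g).-1.
    have -> : ((size g).-1 - (size g - size f) = (size f).-1)%N by lia.
    by rewrite -!lead_coefE mulrC subrr.
  have lt_gj : ((size g).-1 < j)%N by rewrite ltn_neqAle eq_sym ne_j.
  have -> : g`_j = 0 by rewrite nth_default //; move: lt_gj; case: (size g).
  have -> : f`_(j - (size g - size f)) = 0.
    rewrite nth_default //; move: lt_gj le_fg sf. by move: (size g) (size f) => a b; lia.
  by rewrite !mulr0 subr0.
- by rewrite rpredB ?polyOverZ // rpredM // rpredX ?polyOverX.
- by rewrite hw dualM /= gz mulr0.
Qed.

Lemma derivation_graph_functional (G : subringClosed dual) z c c' :
  derivation_graph G -> ((z, c) : dual) \in G -> ((z, c') : dual) \in G -> c = c'.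
Proof.
move=> Gder Gc Gc'.
by have := Gder _ (rpredB Gc Gc') (subrr z) => -[_ /subr0_eq].
Qed.

Variable t : K.
Hypothesis t_transc : forall f : {poly int}, f != 0 -> (map_poly intr f).[t] != 0.

Let good (A : set dual) : Prop :=
  [/\ subring_closed (mem A), derivation_graph (mem A) & ((t, 1) : dual) \in A].

(** The graph of the derivation sending f(t) to f'(t) on Z[t]. *)
Let base : set dual :=
  [set x | exists f : {poly int}, x = (map_poly intr f).[(t, 1) : dual]].

(** Transcendence of [t] makes f'(t) depend only on f(t). *)
Let base_good : good base.
Proof.
split.
- split=> [|x y|x y]; rewrite ?inE.
  + by exists 1; rewrite rmorph1 hornerC.
  + by move=> [f ->] [g ->]; exists (f - g); rewrite rmorphB hornerD hornerN.
  + by move=> [f ->] [g ->]; exists (f * g); rewrite rmorphM hornerM.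
- move=> x; rewrite inE => -[f ->] fst0.
  have [->|f0] := eqVneq f 0; first by rewrite rmorph0 horner0.
  case/eqP: (t_transc f0).
  rewrite -[RHS]fst0 -[RHS]/(dual_fst _) -horner_map -map_poly_comp.
  by congr (_.[_]); apply: eq_map_poly => n; rewrite /= rmorph_int.
- by rewrite inE; exists 'X; rewrite map_polyX hornerX.
Qed.

Let exists_maximal : exists A, good A /\ forall B, good B -> (A `<=` B)%classic -> B = A.
Proof.
have [F FP tot|A [PA Amax]] := @Zorn_bigcup _ [set A | A = set0 \/ good A]%classic.
  have [[X [FX Xg]]|noX] := pselect (exists X, F X /\ good X); last first.
    left; apply/seteqP; split=> // x [X FX Xx]; have [X0|Xg] := FP _ FX.
      by rewrite -X0.
    by case: noX; exists X.
  (* Any two elements of the union lie in one good member of the chain, where closure can be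
     checked. *)
  right; have common x y : x \in (\bigcup_(X in F) X)%classic ->
      y \in (\bigcup_(X in F) X)%classic -> exists Y, [/\ F Y, good Y, x \in Y & y \in Y].
    rewrite !inE => -[Y FY Yx] [Z FZ Zy].
    have [Yg Zg] : good Y /\ good Z.
      by split; [have [E|] := FP _ FY | have [E|] := FP _ FZ] => //; exfalso;
        [move: Yx | move: Zy]; rewrite E.
    by have [YZ|ZY] := tot _ _ FY FZ; [exists Z | exists Y]; rewrite !inE; split=> //;
      [apply: YZ | apply: ZY].
  have sub Y x : F Y -> x \in Y -> x \in (\bigcup_(X in F) X)%classic.
    by rewrite !inE => FY Yx; exists Y.
  have [[X1 _ _] _ Xt] := Xg.
  split; last exact: sub FX Xt.
    split=> [|x y ux uy|x y ux uy]; first exact: sub FX X1.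
      by have [Y [FY [[_ YB _] _ _] Yx Yy]] := common x y ux uy; apply: (sub Y) => //; apply: YB.
    by have [Y [FY [[_ _ YM] _ _] Yx Yy]] := common x y ux uy; apply: (sub Y) => //; apply: YM.
  by move=> x ux; have [Y [FY [_ Yd _] Yx _]] := common x x ux ux; apply: Yd.
have Ag : good A.
  case: PA => // A0; exfalso; apply: (Amax base); last by right.
  split; first by rewrite A0.
  by case: base_good => _ _; rewrite inE A0 => b /(_ _ b).
exists A; split=> // B Bg AB; apply: contrapT => BA; apply: (Amax B); last by right.
by split=> // BA'; apply: BA; apply/seteqP.
Qed.

(** A maximal graph has domain [K]: with [c] from [derivation_graph_extend], the values at [(z, c)]
    of polynomials over it form a good set containing it, so by maximality [(z, c)] is already
    there. *)
Lemma derivation_exists : exists d : K -> K,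
  [/\ {morph d : a b / a + b}, forall a b, d (a * b) = a * d b + d a * b & d t = 1].
Proof.
have [A [[A_closed Ader At] Amax]] := exists_maximal.
have [G GA] := subringClosed_of A_closed.
have Gder : derivation_graph G by move=> x; rewrite GA; apply: Ader.
have /boolp.choice[d dG] z : exists c, ((z, c) : dual) \in G.
  have [c zc] := derivation_graph_extend z Gder.
  exists c; rewrite GA.
  pose B : set dual := [set x | exists2 g, g \is a polyOver G & x = g.[(z, c) : dual]]%classic.
  have AB : (A `<=` B)%classic.
    move=> x Ax; exists x%:P; last by rewrite hornerC.
    by rewrite polyOverC GA; apply: mem_set.
  rewrite -[A](Amax B) //.
    rewrite !inE; exists 'X; last by rewrite hornerX.
    exact: polyOverX.
  split.
  - split=> [|x y|x y]; rewrite ?inE.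
    + by exists 1; rewrite ?hornerC // rpred1.
    + by move=> [f fG ->] [g gG ->]; exists (f - g); rewrite ?hornerD ?hornerN ?rpredB.
    + by move=> [f fG ->] [g gG ->]; exists (f * g); rewrite ?hornerM ?rpredM.
  - by move=> x; rewrite inE => -[g gG ->]; apply: zc.
  - by move: At; rewrite !inE; apply: AB.
exists d; split=> [x y|x y|].
- exact: derivation_graph_functional Gder (dG _) (rpredD (dG x) (dG y)).
- exact: derivation_graph_functional Gder (dG _) (rpredM (dG x) (dG y)).
- by apply: derivation_graph_functional Gder (dG _) _; rewrite GA.
Qed.

End DualNumbers.

(** * Arithmetic of Z_p: divisibility, completeness, units, Hensel's lemma, a transcendental
    element *)

Section PadicIntegers.
Variables (p : nat) (p_prime : prime p).
Local Notation Zp := (padic_int p_prime).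
Implicit Types (x y z a b : Zp) (g : {poly Zp}).

Definition pdvd k x := exists y, x = p%:R ^+ k * y.

Lemma pdvdD k x y : pdvd k x -> pdvd k y -> pdvd k (x + y).
Proof. by move=> [a ->] [b ->]; exists (a + b); rewrite mulrDr. Qed.

Lemma pdvdN k x : pdvd k x -> pdvd k (- x).
Proof. by move=> [a ->]; exists (- a); rewrite mulrN. Qed.

Lemma pdvdB k x y : pdvd k x -> pdvd k y -> pdvd k (x - y).
Proof. by move=> kx ky; apply/pdvdD/pdvdN. Qed.

Lemma pdvdMl k x y : pdvd k y -> pdvd k (x * y).
Proof. by move=> [b ->]; exists (x * b); rewrite mulrCA. Qed.

Lemma pdvdMr k x y : pdvd k x -> pdvd k (x * y).
Proof. by rewrite mulrC; apply: pdvdMl. Qed.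

Lemma pdvdM k l x y : pdvd k x -> pdvd l y -> pdvd (k + l) (x * y).
Proof. by move=> [a ->] [b ->]; exists (a * b); rewrite exprD mulrACA. Qed.

Lemma pdvdW k l x : (k <= l)%N -> pdvd l x -> pdvd k x.
Proof. by move=> /subnKC <- [a ->]; exists (p%:R ^+ (l - k) * a); rewrite exprD mulrA. Qed.

Lemma pdvd_pX k : pdvd k (p%:R ^+ k).
Proof. by exists 1; rewrite mulr1. Qed.

Lemma pdvd0 k : pdvd k 0.
Proof. by exists 0; rewrite mulr0. Qed.

Lemma residue_natr m n : residue (m%:R : Zp) n = m%:R.
Proof. by elim: m => // m IH; rewrite mulrS residueD IH [RHS]mulrS. Qed.

Lemma residueB x y n : residue (x - y) n = residue x n - residue y n.
Proof. by []. Qed.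

Lemma residueK n (a : 'Z_(p ^ n.+1)) : (nat_of_ord a)%:R = a.
Proof. exact: natr_Zp. Qed.

Lemma pdvd_residue x n : pdvd n.+1 x <-> residue x n = 0.
Proof.
have gt1 := expp_gt1 p_prime; split=> [[y ->]|xn0].
  by rewrite residueM -natrX residue_natr -(Zp_nat_mod (gt1 n)) modnn mul0r.
(* The cofactor modulo p^(k+1): dividing by p^(n+1) costs n + 1 levels of precision, hence the
   shifted index. *)
pose q k := (residue x (n.+1 + k) %/ p ^ n.+1)%N.
have q_mod k : q k = (q k.+1 %% p ^ k.+1)%N.
  rewrite /q modn_divl -expnD (@residue_modn _ _ x (n.+1 + k) (n.+1 + k.+1)) ?leq_add2l //.
  by congr (_ %% p ^ _ %/ _)%N; rewrite [in LHS]addnC -addSn.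
pose y : residue_seq p := fun k => (q k)%:R.
have y_coh : y \in coherent p_prime.
  apply/coherentP => k; rewrite (coherent_natr p_prime (erefl : y k.+1 = (q k.+1)%:R)).
  by rewrite /y [in RHS]q_mod Zp_nat_mod.
exists (SubringElem y_coh); apply: residue_inj => k.
rewrite residueM -natrX residue_natr /residue /= -/(residue x k) /y -natrM.
rewrite mulnC divnK; last first.
  by rewrite /dvdn -(@residue_modn _ _ x n) ?xn0 // addSnnS leq_addr.
by rewrite -(Zp_nat_mod (gt1 k)) -(@residue_modn _ _ x k) ?residueK // leq_addl.
Qed.

Lemma pdvd_all0 x : (forall n, pdvd n.+1 x) -> x = 0.
Proof. by move=> x0; apply: residue_inj => n; apply/pdvd_residue. Qed.

Lemma natr_dense x n : exists m : nat, pdvd n.+1 (x - m%:R).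
Proof.
by exists (residue x n); apply/pdvd_residue; rewrite residueB residue_natr residueK subrr.
Qed.

(** The limit is the diagonal: its residue at level [n] is that of [u n]. *)
Lemma padic_complete (u : nat -> Zp) :
  (forall n, pdvd n.+1 (u n.+1 - u n)) -> exists x, forall n, pdvd n.+1 (x - u n).
Proof.
move=> u_cauchy; pose y : residue_seq p := fun n => residue (u n) n.
have y_coh : y \in coherent p_prime.
  apply/coherentP => n; rewrite /y residueS; apply/eqP; rewrite -subr_eq0 -residueB.
  exact/eqP/pdvd_residue.
exists (SubringElem y_coh) => n; apply/pdvd_residue.
by rewrite residueB /residue /= subrr.
Qed.

Lemma not_pdvd_p1 : ~ pdvd 1 (1 : Zp).
Proof. by move/pdvd_residue/eqP; rewrite -[1]/(1%:R) residue_natr oner_eq0. Qed.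

(** As n + 1 < p^(n+2), reduction modulo p^(n+2) leaves [n.+1] unchanged. *)
Lemma padic_natr_neq0 n : n.+1%:R != 0 :> Zp.
Proof.
apply/eqP => /(congr1 (fun x => nat_of_ord (residue x n.+1))).
rewrite residue_natr val_Zp_nat ?expp_gt1 // modn_small //.
by rewrite (ltn_trans (ltn_expl n.+1 (prime_gt1 p_prime))) // ltn_exp2l ?prime_gt1.
Qed.

Lemma p_neq0 : p%:R != 0 :> Zp.
Proof. by have := padic_natr_neq0 p.-1; rewrite prednK ?prime_gt0. Qed.

Lemma pX_neq0 n : p%:R ^+ n != 0 :> Zp.
Proof. by rewrite expf_neq0 ?p_neq0. Qed.

Lemma padic_unitE x : x \is a GRing.unit <-> ~ pdvd 1 x.
Proof.
split=> [xU [y /(congr1 ( *%R x^-1))]|nx].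
  rewrite mulVr // => E; apply: not_pdvd_p1; rewrite E.
  exact/pdvdMl/pdvdMr/pdvd_pX.
have [y0 y0P] : exists y, pdvd 1 (1 - x * y).
  have xU : residue x 0 \is a GRing.unit.
    rewrite -[residue x 0]residueK unitZpE ?expp_gt1 // coprime_pexpl // prime_coprime //.
    apply/negP => pa; apply: nx; apply/pdvd_residue.
    rewrite -[residue x 0]residueK -(Zp_nat_mod (expp_gt1 p_prime 0)).
    by rewrite (_ : (_ %% p ^ 1 = 0)%N) //; apply/eqP.
  exists (nat_of_ord (residue x 0)^-1)%:R; apply/pdvd_residue.
  by rewrite residueB residueM residue_natr residueK mulrV // subrr.
(* Newton iteration for the inverse of [x], started at an inverse modulo p; each step squares the
   error [1 - x * u n]. *)
pose u := fix u n := if n is m.+1 then u m * (1 + (1 - x * u m)) else y0.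
have uP n : pdvd n.+1 (1 - x * u n).
  elim: n => //= n IH.
  have -> : 1 - x * (u n * (1 + (1 - x * u n))) = (1 - x * u n) * (1 - x * u n) by ring.
  by apply: (@pdvdW _ (n.+1 + n.+1)); [lia | apply: pdvdM].
have [|y yP] := @padic_complete u.
  by move=> n /=; rewrite mulrDr mulr1 addrAC subrr add0r; apply: pdvdMl.
apply/unitrPr; exists y; apply/esym/subr0_eq/pdvd_all0 => n.
have -> : 1 - x * y = (1 - x * u n) - x * (y - u n) by ring.
by apply: pdvdB (uP n) (pdvdMl _ _).
Qed.

(** The valuation is the least [n] such that p^(n+1) does not divide [x]. *)
Lemma padic_decomp x : x != 0 -> exists n y, x = p%:R ^+ n * y /\ y \is a GRing.unit.
Proof.
move=> x0; have ex : exists n, ~~ `[< pdvd n.+1 x >].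
  apply: contrapT => no; case/eqP: x0; apply: pdvd_all0 => n.
  by apply/asboolP; apply: contrapT => /negP nn; apply: no; exists n.
have [n /asboolP nx nmin] := ex_minnP ex.
have [y xy] : pdvd n x.
  case: n nx nmin => [|n] nx nmin; first by exists x; rewrite mul1r.
  by apply: contrapT => /asboolPn/nmin; rewrite ltnn.
exists n, y; split=> //; apply/padic_unitE => -[z yz]; apply: nx.
by exists z; rewrite xy yz mulrA -exprD addn1.
Qed.

Lemma horner_taylor2 (R : comNzRingType) (f : {poly R}) (u h : R) :
  exists k, f.[u + h] = f.[u] + f^`().[u] * h + h * h * k.
Proof.
elim/poly_ind: f => [|f c [k IH]]; first by exists 0; rewrite deriv0 !horner0; ring.
exists (f^`().[u] + k * (u + h)).
by rewrite derivD derivM derivX derivC !hornerE IH; ring.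
Qed.

Lemma pdvd_horner g a b k : pdvd k (b - a) -> pdvd k (g.[b] - g.[a]).
Proof.
move=> ab; have [c] := horner_taylor2 g a (b - a); rewrite addrC subrK => ->.
have -> : g.[a] + g^`().[a] * (b - a) + (b - a) * (b - a) * c - g.[a] =
  (b - a) * (g^`().[a] + (b - a) * c) by ring.
exact: pdvdMr.
Qed.

(** Newton's method with the slope frozen at [a]; gaining one power of p per step is enough. *)
Lemma padic_hensel g a : pdvd 1 g.[a] -> g^`().[a] \is a GRing.unit ->
  exists b, g.[b] = 0 /\ pdvd 1 (b - a).
Proof.
move=> ga g'a; pose v := g^`().[a]^-1.
pose u := fix u n := if n is m.+1 then u m - g.[u m] * v else a.
have uP n : pdvd n.+1 g.[u n] /\ pdvd 1 (u n - a).
  elim: n => [|n [IH1 IH2]] /=; first by rewrite subrr; split=> //; apply: pdvd0.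
  split; last first.
    rewrite addrAC; apply: pdvdB IH2 (pdvdMr _ (pdvdW _ IH1)) => //.
  have [k ->] := horner_taylor2 g (u n) (- (g.[u n] * v)).
  (* The first product gains a factor p because [u n] is congruent to [a] modulo p, the second
     because it is quadratic in [g.[u n]]. *)
  have -> : g.[u n] + g^`().[u n] * - (g.[u n] * v) + - (g.[u n] * v) * - (g.[u n] * v) * k =
    g.[u n] * (g^`().[a] * v - g^`().[u n] * v) + g.[u n] * g.[u n] * (v * v * k).
    by rewrite mulrV //; ring.
  apply: pdvdD; last by apply/pdvdMr/(@pdvdW _ (n.+1 + n.+1)); [lia|apply: pdvdM].
  rewrite -addn1; apply: pdvdM => //; rewrite -mulrBl -opprB.
  exact/pdvdMr/pdvdN/pdvd_horner.
have [|b bP] := @padic_complete u.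
  by move=> n /=; rewrite addrAC subrr add0r; apply/pdvdN/pdvdMr/(uP n).1.
exists b; split; last exact: bP 0.
apply: pdvd_all0 => n; rewrite -[g.[b]](subrK g.[u n]).
by apply: pdvdD (pdvd_horner g (bP n)) (uP n).1.
Qed.

(** The pair [s] encodes a ball by its centre and the exponent of its radius. The first [size g]
    points [c j] are distinct, so one is not a root, and continuity of [g] gives a ball around
    it. *)
Lemma avoid_roots g a m : g != 0 ->
  exists s : Zp * nat, [/\ pdvd m (s.1 - a), (m < s.2)%N &
    forall x, pdvd s.2 (x - s.1) -> g.[x] != 0].
Proof.
move=> g0; pose c j := a + p%:R ^+ m * j%:R.
have [j gj] : exists j, g.[c j] != 0.
  apply: contrapT => no.
  suff : (size (map c (iota 0 (size g))) < size g)%N by rewrite size_map size_iota ltnn.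
  apply: max_poly_roots g0 _ _; last rewrite map_inj_uniq ?iota_uniq //.
  - apply/allP => _ /mapP[j _ ->]; rewrite rootE; apply: contrapT => /negP gj.
    by apply: no; exists j.
  - move=> i j /addrI /(mulfI (pX_neq0 m)) /eqP.
    wlog le_ij : i j / (i <= j)%N.
      by move=> H; case: (leqP i j) => [/H|/ltnW/H H' E]; [apply | apply/esym/H'; rewrite eq_sym].
    rewrite eq_sym -subr_eq0 -natrB // => E; apply/eqP; rewrite eqn_leq le_ij -subn_eq0.
    by case: (j - i)%N E => // n; rewrite (negPf (padic_natr_neq0 n)).
have [k nk] : exists k, ~ pdvd k g.[c j].
  apply: contrapT => no; case/eqP: gj; apply: pdvd_all0 => n.
  by apply: contrapT => nn; apply: no; exists n.+1.
(* The exponent [k] keeps [g] nonzero modulo p^k, and [m.+1] forces the ball to shrink. *)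
exists (c j, maxn k m.+1); split=> /=; first by rewrite /c addrAC subrr add0r; apply/pdvdMr/pdvd_pX.
  by rewrite leq_max ltnSn orbT.
move=> x /(pdvdW (leq_maxl _ _)) /(pdvd_horner g) xj; apply/eqP => gx0.
by apply: nk; rewrite -[g.[_]]opprK; apply: pdvdN; move: xj; rewrite gx0 add0r.
Qed.

(* [t] is the limit of nested balls, the n-th of which avoids the roots of the
   n-th integer polynomial. *)
Lemma exists_transcendental :
  exists t : Zp, forall f : {poly int}, f != 0 -> (map_poly intr f).[t] != 0.
Proof.
have intr0 (f : {poly int}) : f != 0 -> map_poly intr f != 0 :> {poly Zp}.
  move=> f0; rewrite map_poly_eq0_id0 //.
  have: lead_coef f != 0 by rewrite lead_coef_eq0.
  case: (lead_coef f) => [[|n]|n] // _; first exact: padic_natr_neq0.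
  by rewrite NegzE mulrNz oppr_eq0 padic_natr_neq0.
(* Numbers that encode no polynomial are sent to 0, for which [step] merely shrinks the ball. *)
pose F (n : nat) : {poly Zp} :=
  if @unpickle {poly int} n is Some f then map_poly intr f else 0.
have step (ns : nat * (Zp * nat)) : exists s : Zp * nat,
    [/\ pdvd ns.2.2 (s.1 - ns.2.1), (ns.2.2 < s.2)%N &
      F ns.1 != 0 -> forall x, pdvd s.2 (x - s.1) -> (F ns.1).[x] != 0].
  have [F0|F0] := eqVneq (F ns.1) 0.
    by exists (ns.2.1, ns.2.2.+1); rewrite /= subrr; split=> //; apply: pdvd0.
  by have [s [s1 s2 s3]] := avoid_roots ns.2.1 ns.2.2 F0; exists s.
have [h hP] := boolp.choice step.
(* Exponents start at 1 and increase strictly, so the n-th exceeds [n], the rate that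
   [padic_complete] requires. *)
pose u := fix u n := if n is m.+1 then h (m, u m) else (0, 1%N).
have u_gt n : (n < (u n).2)%N.
  by elim: n => //= n IH; have [_ + _] := hP (n, u n); apply: leq_ltn_trans.
have u_near n k : pdvd (u n).2 ((u (n + k)%N).1 - (u n).1).
  suff: ((u n).2 <= (u (n + k)%N).2)%N /\ pdvd (u n).2 ((u (n + k)%N).1 - (u n).1) by case.
  elim: k => [|k [IH1 IH2]]; first by rewrite addn0 subrr; split=> //; apply: pdvd0.
  have [h1 h2 _] := hP ((n + k)%N, u (n + k)%N).
  rewrite addnS /=; split; first exact: leq_trans IH1 (ltnW h2).
  rewrite -(subrK (u (n + k)%N).1 (h _).1) -addrA; apply: pdvdD IH2.
  exact: pdvdW h1.
have [|t tP] := @padic_complete (fun n => (u n).1).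
  by move=> n; apply: pdvdW (u_gt n) _; rewrite -addn1; apply: u_near.
exists t => f f0; have [_ _] := hP (pickle f, u (pickle f)).
rewrite /F /= pickleK; apply; first exact: intr0.
set m := (pickle f).+1; rewrite -[h _]/(u m).
(* The intermediate centre is taken far enough along to be as close to [t] as the radius of the m-th
   ball demands. *)
rewrite -(subrK (u (m + (u m).2)%N).1 t) -addrA; apply: pdvdD (u_near _ _).
by apply: pdvdW (tP _); rewrite leqW // leq_addl.
Qed.

End PadicIntegers.

(** * Commutative algebra of a domain with finite quotients modulo powers of [q] *)

Section FiniteQuotients.
Variables (A : comNzRingType) (q : A) (M : {pred A}).
Hypothesis A_domain : integral_domain A.
Hypothesis q_neq0 : q != 0.
Hypothesis M_ideal : idealr_closed M.
Hypothesis qM : q \in M.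
Hypothesis unitM : forall x, x \notin M -> exists y, x * y = 1.
Hypothesis dvd_qX : forall x, x != 0 -> exists m y, q ^+ m = x * y.
Hypothesis sqrM : forall x, x \in M -> exists y, x * x = q * y.
Hypothesis finite_quotient : forall m, exists (T : finType) (r : A -> T),
  forall x y, r x = r y -> exists z, x - y = q ^+ m * z.

Lemma idealrD (I : {pred A}) x y : idealr_closed I -> x \in I -> y \in I -> x + y \in I.
Proof. by move=> [_ _ I_lin] xI yI; rewrite -[x]mul1r I_lin. Qed.

Lemma idealrMr (I : {pred A}) x y : idealr_closed I -> x \in I -> x * y \in I.
Proof. by move=> [I0 _ I_lin] xI; rewrite -[_ * _]addr0 mulrC I_lin. Qed.

Lemma proper_ideal_sub (I : {pred A}) : idealr_closed I -> {subset I <= M}.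
Proof.
move=> I_ideal x xI; apply: contrapT => /negP /unitM[y xy].
by case: I_ideal (idealrMr y I_ideal xI) => _ /negPf I1 _; rewrite xy I1.
Qed.

Lemma maximal_ideal_eq (M' : {pred A}) : maximal_ideal M' -> M' =i M.
Proof.
move=> [M'_ideal M'max] x; apply/idP/idP; first exact: proper_ideal_sub.
by apply: M'max => //; apply: proper_ideal_sub.
Qed.

(** Elements outside [M] are invertible, so [M] contains every proper ideal; [q] is a nonzero
    nonunit. *)
Lemma local_of_nonunits : local_ring A.
Proof.
split=> [fld|].
  have [y qy] := fld q q_neq0; have [_ /negP M1 _] := M_ideal.
  by apply: M1; rewrite -qy; apply: idealrMr.
exists M; split; last exact: maximal_ideal_eq.
by split=> // J J_ideal _; apply: proper_ideal_sub.
Qed.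

Lemma prime_zero : prime_ideal (pred1 (0 : A)).
Proof.
split=> [|x y]; rewrite ?inE; last by move/eqP/A_domain.
split; rewrite ?inE ?eqxx ?oner_eq0 // => a x y; rewrite !inE => /eqP-> /eqP->.
by rewrite mulr0 addr0.
Qed.

Lemma prime_nonunits : prime_ideal M.
Proof.
split=> // x y xyM; apply: contrapT => /negP; rewrite negb_or => /andP[].
move=> /unitM[x' xx'] /unitM[y' yy']; have [_ /negP M1 _] := M_ideal; apply: M1.
by rewrite -[1]mulr1 -{1}xx' -yy' mulrACA; apply: idealrMr.
Qed.

(** Some power of [q] is a multiple of [x], so [q] is in [P]; squares of elements of [M] are
    multiples of [q], so [M] follows. *)
Lemma prime_sub (P : {pred A}) x :
  prime_ideal P -> x \in P -> x != 0 -> {subset M <= P}.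
Proof.
move=> [P_ideal P_prime] xP /dvd_qX[m [y qm]].
have qP : q \in P.
  have : q ^+ m \in P by rewrite qm; apply: idealrMr.
  elim: m {qm} => [|m IH]; first by rewrite expr0; case: P_ideal => _ /negPf->.
  by rewrite exprS => /P_prime /orP[].
move=> e /sqrM[z ez]; have /P_prime : e * e \in P by rewrite ez; apply: idealrMr.
by rewrite orbb.
Qed.

(** The chain from 0 to [M] is longest: in a longer one the second prime is nonzero, hence contains
    [M] and so the third. *)
Lemma krull_dim1 : has_krull_dim A 1.
Proof.
split.
  exists (fun i => if i is 0%N then (pred1 0 : {pred A}) else M); split=> [[|i] _|[|i] //= _].
  - exact: prime_zero.
  - exact: prime_nonunits.
  - split=> [x|/(_ q qM)]; last by rewrite inE (negPf q_neq0).
    by rewrite inE => /eqP->; case: M_ideal.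
move=> n P [P_prime P_strict]; rewrite leqNgt; apply/negP => lt1n.
have ex (I J : {pred A}) : ~ {subset I <= J} -> exists2 x, x \in I & x \notin J.
  move=> IJ; apply: contrapT => no; apply: IJ => x xI; apply: contrapT => /negP xJ.
  by apply: no; exists x.
have [x xP1 xP0] := ex _ _ (P_strict 0%N (ltnW lt1n)).2.
have [y yP2 yP1] := ex _ _ (P_strict 1%N lt1n).2.
have x0 : x != 0.
  by apply: contraNneq xP0 => ->; case: (P_prime 0%N (leq0n n)) => -[].
case/negP: yP1; apply: (prime_sub (P_prime 1%N (ltnW lt1n)) xP1 x0).
by apply: proper_ideal_sub yP2; case: (P_prime 2%N lt1n).
Qed.

(** Generators are [a] and one representative in [I] of each class that meets [I]. *)
Lemma finite_quotient_generates (I : {pred A}) (a : A) (T : finType) (r : A -> T) :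
  idealr_closed I -> a \in I -> (forall x y, r x = r y -> exists z, x - y = a * z) ->
  exists s, generates s I.
Proof.
move=> I_ideal aI rP; have [I0 _ _] := I_ideal.
(* Classes that miss [I] get the representative 0. *)
have /boolp.choice[g gP] (j : T) : exists x, x \in I /\ forall y, y \in I -> r y = j -> r x = j.
  have [[x [xI xj]]|no] := pselect (exists x, x \in I /\ r x = j); first by exists x.
  by exists 0; split=> // y yI yj; case: no; exists y.
exists (a :: map g (enum T)) => x; split=> [xI|[c ->]]; last first.
  rewrite big_ord_recl; elim/big_rec: _ => [|[i lti] y _ yI] /=.
    by rewrite addr0 mulrC; apply: idealrMr.
  rewrite addrCA; apply: idealrD => //; rewrite mulrC; apply: idealrMr => //.
  rewrite (nth_map (r x)); last by rewrite -(size_map g).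
  by case: (gP (nth (r x) (enum T) i)).
have [z xz] : exists z, x - g (r x) = a * z.
  by apply: rP; rewrite ((gP (r x)).2 x xI).
(* Index 0 belongs to [a]; the others select the representative of the class of [x]. *)
exists (fun i => if i is j.+1 then (j == index (r x) (enum T))%:R else z).
have lt_index : (index (r x) (enum T) < size (map g (enum T)))%N.
  by rewrite size_map index_mem mem_enum.
rewrite big_ord_recl /= (bigD1 (Ordinal lt_index)) //= eqxx mul1r big1 => [|i ne_i].
  rewrite addr0 (nth_map (r x)) ?index_mem ?mem_enum // nth_index ?mem_enum //.
  by rewrite mulrC -xz subrK.
case: eqP => [E|_]; last by rewrite mul0r.
by case/eqP: ne_i; apply: val_inj.
Qed.

(** A nonzero ideal contains a power of [q], which serves as the [a] of
    [finite_quotient_generates]. *)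
Lemma noetherian_of_finite_quotients : noetherian A.
Proof.
move=> I I_ideal; have [[x [xI x0]]|no] := pselect (exists x, x \in I /\ x != 0).
  have [m [y qm]] := dvd_qX x0; have [T [r rP]] := finite_quotient m.
  by apply: finite_quotient_generates rP => //; rewrite qm; apply: idealrMr.
exists [::] => x; split=> [xI|[c]]; last by rewrite big_ord0 => ->; case: I_ideal.
exists (fun=> 0); rewrite big_ord0; apply: contrapT => /eqP x0.
by apply: no; exists x.
Qed.

End FiniteQuotients.

(** * Fractions and the formal rules of derivations *)

Lemma mulf_div_cancel (K : fieldType) (a b c : K) :
  b != 0 -> c != 0 -> b * (a / (b * c)) * c = a.
Proof. by move=> b0 c0; rewrite mulrAC mulrC divfK ?mulf_neq0. Qed.

Lemma fraction_elim (R : idomainType) (z : {fraction R}) :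
  exists a b : R, b != 0 /\ z = tofrac a / tofrac b.
Proof.
elim/quotW: z => x; exists (frac x).1, (frac x).2; split; first exact: denom_ratioP.
apply: (canRL (mulfK _)); first by rewrite tofrac_eq0 denom_ratioP.
rewrite !piE; apply/eqmodP; rewrite /= FracField.equivfE /FracField.mulf.
by rewrite !numden_Ratio ?mulf_neq0 ?oner_neq0 ?denom_ratioP // !mulr1 mulrC.
Qed.

Section Derivations.
Variables (K : fieldType) (d : K -> K).
Hypothesis dD : {morph d : a b / a + b}.
Hypothesis dM : forall a b, d (a * b) = a * d b + d a * b.

Lemma derivation0 : d 0 = 0.
Proof. by apply: (addIr (d 0)); rewrite -dD !add0r. Qed.

Lemma derivationN a : d (- a) = - d a.
Proof. by apply: (addIr (d a)); rewrite -dD !addNr derivation0. Qed.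

Lemma derivationB a b : d (a - b) = d a - d b.
Proof. by rewrite dD derivationN. Qed.

Lemma derivation1 : d 1 = 0.
Proof.
by apply: (addIr (d 1)); rewrite add0r; have := dM 1 1; rewrite !mul1r mulr1 => <-.
Qed.

Lemma derivation_natr n : d n%:R = 0.
Proof. by elim: n => [|n IH]; rewrite ?derivation0 // mulrS dD IH derivation1 addr0. Qed.

Lemma derivation_natrM n a : d (n%:R * a) = n%:R * d a.
Proof. by rewrite dM derivation_natr mul0r addr0. Qed.

Lemma derivation_natrXM n m a : d (n%:R ^+ m * a) = n%:R ^+ m * d a.
Proof. by rewrite -natrX derivation_natrM. Qed.

End Derivations.

(** * The ring of p-adic integers with integral derivative *)

Section DerivationRing.
Variables (p : nat) (p_prime : prime p).
Local Notation Zp := (padic_int p_prime).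
Local Notation Qp := (padic_num p_prime).
Variable d : Qp -> Qp.
Hypothesis dD : {morph d : a b / a + b}.
Hypothesis dM : forall a b, d (a * b) = a * d b + d a * b.

Definition derivation_ring : {pred Zp} :=
  fun x => `[< exists y, d (tofrac x) = tofrac y >].

Lemma derivation_ringP x :
  reflect (exists y, d (tofrac x) = tofrac y) (x \in derivation_ring).
Proof. exact: asboolP. Qed.

Lemma derivation_ring_closed : subring_closed derivation_ring.
Proof.
split=> [|x y /derivation_ringP[x' dx] /derivation_ringP[y' dy]
         |x y /derivation_ringP[x' dx] /derivation_ringP[y' dy]]; apply/derivation_ringP.
- by exists 0; rewrite !rmorph0 rmorph1 (derivation1 dM).
- by exists (x' - y'); rewrite !rmorphB (derivationB dD) dx dy.
- by exists (x * y' + x' * y); rewrite rmorphD !rmorphM dM dx dy.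
Qed.

Lemma tofrac_inj : injective (@tofrac Zp).
Proof. by move=> x y /eqP; rewrite tofrac_eq => /eqP. Qed.

Lemma tofrac_pX n : tofrac (p%:R ^+ n : Zp) = p%:R ^+ n.
Proof. by rewrite rmorphXn rmorph_nat. Qed.

Lemma frac_pX_neq0 n : p%:R ^+ n != 0 :> Qp.
Proof. by rewrite -tofrac_pX tofrac_eq0 pX_neq0. Qed.

(** A denominator is a power of p times a unit, and the unit can be absorbed in the numerator. *)
Lemma padic_num_denom (z : Qp) : exists m (y : Zp), p%:R ^+ m * z = tofrac y.
Proof.
have [a [b [b0 ->]]] := fraction_elim z.
have [m [u [bE uU]]] := padic_decomp b0.
exists m, (a * u^-1).
have u0 : tofrac u != 0 by rewrite tofrac_eq0; apply: contraTneq uU => ->; rewrite unitr0.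
apply: (mulIf u0); rewrite -rmorphM mulrVK //.
rewrite bE (tofracM (_ ^+ _)) tofrac_pX.
exact: mulf_div_cancel (frac_pX_neq0 m) u0.
Qed.

Variable S : subringClosed Zp.
Hypothesis S_def : S =i derivation_ring.

Local Notation A := (subring_type S).

Lemma subring_deriv (e : A) : exists y, d (tofrac (val e)) = tofrac y.
Proof. by apply/derivation_ringP; rewrite -S_def; apply: subring_valP. Qed.

Lemma subring_of (x y : Zp) : d (tofrac x) = tofrac y -> exists e : A, val e = x.
Proof.
move=> dx; have xS : x \in S by rewrite S_def; apply/derivation_ringP; exists y.
by exists (SubringElem xS).
Qed.

Lemma val_pX n : val (p%:R ^+ n : A) = p%:R ^+ n.
Proof. by rewrite rmorphXn rmorph_nat. Qed.

Lemma subring_dvd_pX (e : A) n u :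
  val e = p%:R ^+ n * u -> u \is a GRing.unit -> exists f : A, p%:R ^+ (n + n) = e * f.
Proof.
move=> eE uU; have [y dy] := subring_deriv e.
have e0 : tofrac (val e) != 0.
  rewrite tofrac_eq0 eE mulf_neq0 ?pX_neq0 //.
  by apply: contraTneq uU => ->; rewrite unitr0.
(* With e = p^n u, these are p^(2n) / e and its derivative - p^(2n) y / e^2. *)
have [|f fE] := @subring_of (p%:R ^+ n * u^-1) (- (y * (u^-1 * u^-1))).
  have eq_pX : val e * (p%:R ^+ n * u^-1) = p%:R ^+ (n + n).
    by rewrite eE mulrACA mulrV // mulr1 exprD.
  have : d (tofrac (val e * (p%:R ^+ n * u^-1))) = d (tofrac (p%:R ^+ (n + n))).
    by rewrite eq_pX.
  rewrite tofrac_pX -[p%:R ^+ (n + n)]mulr1 (derivation_natrXM dD dM) (derivation1 dM) mulr0.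
  rewrite rmorphM dM dy => /eqP; rewrite addr_eq0 => /eqP E; apply: (mulfI e0).
  rewrite E -!rmorphM -!rmorphN; congr tofrac.
  rewrite eE; transitivity (- (y * (p%:R ^+ n * (u * u^-1) * u^-1))); last by ring.
  by rewrite mulrV // mulr1.
exists f; apply: val_inj; rewrite rmorphM /= val_pX fE eE mulrACA mulrV // mulr1.
by rewrite exprD.
Qed.

Definition subring_nonunits : {pred A} := fun e => `[< pdvd 1 (val e) >].

Lemma subring_nonunitsP e : reflect (pdvd 1 (val e)) (e \in subring_nonunits).
Proof. exact: asboolP. Qed.

Lemma subring_nonunits_ideal : idealr_closed subring_nonunits.
Proof.
split.
- by apply/subring_nonunitsP; rewrite rmorph0; apply: pdvd0.
- by apply/subring_nonunitsP; rewrite rmorph1; apply: not_pdvd_p1.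
- move=> a x y /subring_nonunitsP px /subring_nonunitsP py; apply/subring_nonunitsP.
  by rewrite rmorphD rmorphM; apply: pdvdD py; apply: pdvdMl.
Qed.

Lemma subring_p_nonunit : p%:R \in subring_nonunits.
Proof. by apply/subring_nonunitsP; rewrite rmorph_nat; exists 1; rewrite mulr1. Qed.

Lemma subring_p_neq0 : p%:R != 0 :> A.
Proof.
by apply/eqP => /(congr1 val)/eqP; rewrite rmorph_nat rmorph0 (negPf (p_neq0 p_prime)).
Qed.

(** The case of valuation 0 in [subring_dvd_pX]. *)
Lemma subring_unit (e : A) : e \notin subring_nonunits -> exists f, e * f = 1.
Proof.
move=> /subring_nonunitsP /padic_unitE eU.
have [|f ef] := @subring_dvd_pX e 0 (val e) _ eU; first by rewrite mul1r.
by exists f; rewrite -ef.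
Qed.

Lemma subring_neq0_dvd (e : A) : e != 0 -> exists m f, p%:R ^+ m = e * f.
Proof.
move=> e0; have [|n [u [eE uU]]] := @padic_decomp _ p_prime (val e).
  by rewrite -(inj_eq val_inj) rmorph0 in e0.
by exists (n + n)%N; apply: subring_dvd_pX eE uU.
Qed.

(** Writing e = p y, the cofactor is p y^2. Although d y may not be integral, p d y = d e is, hence
    so is d (p y^2) = 2 y d e. *)
Lemma subring_sqr (e : A) : e \in subring_nonunits -> exists f, e * e = p%:R * f.
Proof.
move=> /subring_nonunitsP[y]; rewrite expr1 => eE; have [x' dx] := subring_deriv e.
have [|f fE] := @subring_of (p%:R * y * y) (y * x' + x' * y).
  rewrite -eE tofracM dM dx tofracD !tofracM; congr (_ + _).
  rewrite -dx eE [tofrac (_ * y)]tofracM rmorph_nat (derivation_natrM dD dM).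
  by rewrite mulrCA mulrA.
by exists f; apply: val_inj; rewrite !rmorphM rmorph_nat /= fE eE; ring.
Qed.

Lemma subring_finite_quotient m : exists (T : finType) (r : A -> T),
  forall x y, r x = r y -> exists z, x - y = p%:R ^+ m * z.
Proof.
have /boolp.choice[x' dx] := subring_deriv.
(* Level [m] of [residue] means modulo p^(m+1), one power more than the conclusion asks. *)
exists ('Z_(p ^ m.+1) * 'Z_(p ^ m.+1))%type, (fun e => (residue (val e) m, residue (x' e) m)).
move=> x y [/eqP]; rewrite -subr_eq0 -residueB => /eqP/pdvd_residue/(pdvdW (leqnSn m))[a aE].
move=> /eqP; rewrite -subr_eq0 -residueB => /eqP/pdvd_residue/(pdvdW (leqnSn m))[b bE].
have [|f fE] := @subring_of a b; last first.
  by exists f; apply: val_inj; rewrite rmorphB rmorphM /= val_pX fE.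
apply: (mulfI (frac_pX_neq0 m)).
rewrite -(derivation_natrXM dD dM) -tofrac_pX -!rmorphM -aE -bE !rmorphB (derivationB dD).
by rewrite !dx.
Qed.

Lemma subring_domain : integral_domain A.
Proof.
move=> x y /(congr1 val); rewrite rmorphM rmorph0 => /eqP.
by rewrite mulf_eq0 -!(inj_eq val_inj) !rmorph0.
Qed.

Lemma subring_local : local_ring A.
Proof.
exact: local_of_nonunits subring_p_neq0 subring_nonunits_ideal subring_p_nonunit subring_unit.
Qed.

(** Here [y] is the value at [b] of [g] with [d] applied to its coefficients, integral because they
    lie in [A]. *)
Lemma derivation_horner (g : {poly A}) (b : Zp) : exists y,
  d (tofrac (map_poly val g).[b]) =
  tofrac y + tofrac (map_poly val g)^`().[b] * d (tofrac b).
Proof.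
elim/poly_ind: g => [|g c [y IH]].
  by exists 0; rewrite !rmorph0 deriv0 !horner0 rmorph0 (derivation0 dD); ring.
have [c' dc] := subring_deriv c.
have -> : map_poly val (g * 'X + c%:P) = map_poly val g * 'X + (val c)%:P.
  by rewrite rmorphD rmorphM; congr (_ * _ + _); [apply: map_polyX | apply: map_polyC].
exists (y * b + c'); rewrite derivMXaddC hornerMXaddC hornerD hornerMX.
rewrite !tofracD !tofracM dD dM IH dc.
move: (tofrac y) (d (tofrac b)) => y' b'.
move: (tofrac _) (tofrac _) (tofrac _) (tofrac _) => u v w x.
by rewrite !mulrDl (mulrAC w) (addrCA (x * b')) addrAC.
Qed.

Lemma subring_henselian : henselian A.
Proof.
split=> [|M M_max g a]; first exact: subring_local.
rewrite !(maximal_ideal_eq subring_nonunits_ideal subring_unit M_max).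
move=> /subring_nonunitsP ga /subring_nonunitsP g'a.
have [||b [gb ba]] := @padic_hensel _ p_prime (map_poly val g) (val a).
- by rewrite horner_map.
- by rewrite deriv_map horner_map; apply/padic_unitE.
(* Since [b] is congruent to [a] modulo p, so are the two values of the derivative. *)
have g'b : (map_poly val g)^`().[b] \is a GRing.unit.
  apply/padic_unitE => p_g'b; apply: g'a; rewrite -horner_map -deriv_map.
  by have := pdvdB p_g'b (pdvd_horner (map_poly val g)^`() ba); rewrite opprB addrC subrK.
have [y] := derivation_horner g b; rewrite gb rmorph0 (derivation0 dD) => /eqP.
rewrite eq_sym addrC addr_eq0 => /eqP db.
have [|e eE] := @subring_of b (- y / (map_poly val g)^`().[b]).
  apply: (mulfI (_ : tofrac (map_poly val g)^`().[b] != 0)).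
    by rewrite tofrac_eq0; apply: contraTneq g'b => ->; rewrite unitr0.
  by rewrite db -rmorphM mulrC mulrVK // rmorphN.
exists e; split; last by rewrite (maximal_ideal_eq subring_nonunits_ideal subring_unit M_max);
  apply/subring_nonunitsP; rewrite rmorphB /= eE.
by apply: val_inj; rewrite -horner_map /= eE gb.
Qed.

(** One power of p clears the denominator of [z], and a further one that of the derivative of the
    result. *)
Lemma subring_fraction_field : is_fraction_field (subring_to_padic_num S).
Proof.
split=> [x y /tofrac_inj/val_inj //|z].
have [m [y zy]] := padic_num_denom z.
have [k [y' dy]] := padic_num_denom (d (tofrac y)).
have [|e eE] := @subring_of (p%:R ^+ k * y) y'.
  by rewrite tofracM tofrac_pX (derivation_natrXM dD dM).
exists e, (p%:R ^+ (k + m)); split.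
  by apply/eqP => /(congr1 val)/eqP; rewrite val_pX rmorph0 (negPf (pX_neq0 p_prime _)).
rewrite /subring_to_padic_num /= val_pX eE tofracM !tofrac_pX -zy mulrA -exprD.
by rewrite mulrC mulKf // frac_pX_neq0.
Qed.

(** The ball of radius p^(-n) around [x] contains x + p^n E, because E lies in Z_p. *)
Lemma subring_refines :
  (padic_topology p_prime `<=` adic_topology (subring_to_padic_num S))%classic.
Proof.
move=> U Uo x /Uo[V [[n [b ->]] [z _ xE] VU]].
exists [set p%:R ^+ n * subring_to_padic_num S r + x | r in setT]%classic; split.
- by exists (p%:R ^+ n), x; split=> //; apply: frac_pX_neq0.
- by exists 0; rewrite ?rmorph0 ?mulr0 ?add0r.
- move=> _ [r _ <-]; apply: VU; exists (val r + z) => //.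
  by rewrite -xE tofracD mulrDr addrA.
Qed.

Lemma subring_not_padic_open (t : Zp) : d (tofrac t) = 1 ->
  adic_topology (subring_to_padic_num S) <> padic_topology p_prime.
Proof.
move=> dt E.
pose V := [set 1 * subring_to_padic_num S r + 0 | r in setT]%classic.
have : adic_topology (subring_to_padic_num S) V.
  by move=> x Vx; exists V; split=> //; exists 1, 0; split=> //; apply: oner_neq0.
have V0 : V 0 by exists 0; rewrite // rmorph0 mulr0 addr0.
rewrite E => /(_ _ V0)[W [[n [b ->]] [z0 _ z0E] WV]].
(* The ball contains 0, since p^n z0 + b = 0. Hence p^n Z_p lies in E, and [d] has bounded
   denominators on Z_p. *)
have d_int (z : Zp) : exists y, p%:R ^+ n * d (tofrac z) = tofrac y.
  have [|r _ rE] := WV (p%:R ^+ n * tofrac (z + z0) + b); first by exists (z + z0).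
  have [y dy] := subring_deriv r; exists y; rewrite -dy -(derivation_natrXM dD dM).
  congr d; move: rE; rewrite mul1r addr0 /subring_to_padic_num /= => ->.
  by rewrite tofracD mulrDr -addrA z0E addr0.
(* Write t = m + p^(n+1) z. Then d t = 1 gives p^(n+1) d z = 1, while p^n d z is integral, so p
   would be a unit. *)
have [m [z tz]] := natr_dense t n.
have [y zy] := d_int z.
have dz : p%:R ^+ n.+1 * d (tofrac z) = 1.
  rewrite -(derivation_natrXM dD dM) -tofrac_pX -tofracM -tz tofracB (derivationB dD) dt.
  by rewrite rmorph_nat (derivation_natr dD dM) subr0.
have : tofrac (p%:R ^+ n : Zp) = tofrac (p%:R ^+ n.+1 * y).
  by rewrite tofracM -zy !tofrac_pX mulrCA dz mulr1.
move/tofrac_inj; rewrite exprSr -mulrA -[LHS]mulr1 => /(mulfI (pX_neq0 p_prime _)) E1.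
by apply: (@not_pdvd_p1 p p_prime); exists y.
Qed.

End DerivationRing.

Theorem theorem1p3 (p : nat) (p_prime : prime p) :
  exists E : subringClosed (padic_int p_prime),
    [/\ [/\ integral_domain (subring_type E),
            local_ring (subring_type E),
            henselian (subring_type E),
            noetherian (subring_type E)
          & has_krull_dim (subring_type E) 1],
        is_fraction_field (subring_to_padic_num E)
      & strictly_refines (adic_topology (subring_to_padic_num E))
                         (padic_topology p_prime)].
Proof.
have [t t_transc] := exists_transcendental p_prime.
have [||d [dD dM dt]] := @derivation_exists (padic_num p_prime) _ (tofrac t).
- by move=> n; rewrite -(rmorph_nat (@tofrac (padic_int p_prime))) tofrac_eq0 padic_natr_neq0.
- move=> f f0.
  (* Evaluation commutes with the embedding of Z_p in Q_p, so transcendence passes from [t] to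
     [tofrac t]. *)
  have -> : map_poly intr f = map_poly (@tofrac _) (map_poly intr f : {poly padic_int p_prime}).
    by rewrite -map_poly_comp; apply: eq_map_poly => n; rewrite /= rmorph_int.
  by rewrite horner_map tofrac_eq0; apply: t_transc.
have [E E_def] := subringClosed_of (derivation_ring_closed dD dM).
exists E; split; last split.
- split.
  + exact: subring_domain.
  + exact: (subring_local dD dM E_def).
  + exact: (subring_henselian dD dM E_def).
  + exact: (noetherian_of_finite_quotients (subring_neq0_dvd dD dM E_def)
              (subring_finite_quotient dD dM E_def)).
  + exact: (krull_dim1 (@subring_domain _ _ E) (subring_p_neq0 E)
             (subring_nonunits_ideal E) (subring_p_nonunit E) (subring_unit dD dM E_def)
             (subring_neq0_dvd dD dM E_def) (subring_sqr dD dM E_def)).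
- exact: (subring_fraction_field dD dM E_def).
- exact: subring_refines.
- exact: (subring_not_padic_open dD dM E_def dt).
Qed.
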